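(* Let $(A,\cdot,\bullet)$ be a two-sided skew brace with associative $\star$-product, and let $R:=A/[A^{\cdot},A^{\cdot}]$ be the associated radical ring. For every $n\geq 1$, \[\Gamma_n(A)=\gamma_n(A^{\cdot})\cdot P_n(A).\] Consequently, $A$ is centrally nilpotent if and only if $A^{\cdot}$ is a nilpotent group and $R$ is a nilpotent ring. If $A\neq\{1\}$ and these conditions hold, let $c_{\cdot}$ be the nilpotency class of $A^{\cdot}$ and $c_A$ the central nilpotency class of the skew brace $A$. Then \[c_A=\max\{c_{\cdot},\nu_A-1\},\qquad \max\{c_{\cdot},\nu_R-1\}\leq c_A\leq\max\{c_{\cdot},\nu_R\},\] where $\nu_A:=\min\{n\geq 1: P_n(A)=\{1\}\}$ and $\nu_R:=\min\{n\geq 1: R^n=0\}$.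
   Context: A skew brace is a triple $(A,\cdot,\bullet)$ where $A^{\cdot}=(A,\cdot)$ and $A^{\bullet}=(A,\bullet)$ are groups with the same identity $1$ such that $a\bullet(b\cdot c)=(a\bullet b)\cdot a^{-1}\cdot(a\bullet c)$ for all $a,b,c\in A$, where $a^{-1}$ is the inverse in $A^{\cdot}$. It is two-sided if in addition $(a\cdot b)\bullet c=(a\bullet c)\cdot c^{-1}\cdot(b\bullet c)$ for all $a,b,c$. The $\star$-product is $a\star b:=a^{-1}\cdot(a\bullet b)\cdot b^{-1}$. For subsets $X,Y\subseteq A$, $X\star Y$ is the subgroup of $A^{\cdot}$ generated by all $x\star y$ with $x\in X$, $y\in Y$. For associative $\star$, set $P_1(A):=A$ and, for $n\geq 2$, let $P_n(A)$ be the subgroup of $A^{\cdot}$ generated by all products $a_1\star\cdots\star a_n$ with $a_i\in A$. For subgroups $H,K$ of $A^{\cdot}$, $[H,K]_{\cdot}$ is the subgroup generated by their commutators in $A^{\cdot}$. The lower central series of the group is $\gamma_1(A^{\cdot})=A$, $\gamma_{n+1}(A^{\cdot})=[\gamma_n(A^{\cdot}),A]_{\cdot}$. The lower central series of the skew brace is $\Gamma_1(A):=A$ and, for $n\geq 1$, $\Gamma_{n+1}(A)$ is the subgroup of $A^{\cdot}$ generated by $[\Gamma_n(A),A]_{\cdot}$, $\Gamma_n(A)\star A$ and $A\star\Gamma_n(A)$. $A$ is centrally nilpotent if $\Gamma_n(A)=\{1\}$ for some $n$. For both series, class $c$ means that the $(c+1)$st term is the first trivial term. With $D=[A^{\cdot},A^{\cdot}]$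 the commutator subgroup of $A^{\cdot}$, under the stated hypotheses $R=A/D$ is a (non-unital) radical ring with (well-defined) operations $(aD)+(bD):=(a\cdot b)D$ and $(aD)(bD):=(a\star b)D$. $R^n$ is the additive subgroup of $R$ generated by all products of $n$ elements of $R$ ($R^1=R$); $R$ is nilpotent if $R^n=0$ for some $n$. *)

(* Defs.v *)
From HB Require Import structures.
From mathcomp Require Import all_boot all_order all_algebra.
From mathcomp Require Import generic_quotient boolp classical_sets.

Set Implicit Arguments.
Unset Strict Implicit.
Unset Printing Implicit Defensive.

Import GRing.Theory.
Local Open Scope classical_set_scope.
Local Open Scope quotient_scope.
Local Open Scope group_scope.

(* The carrier A is a possibly infinite MathComp group, which is the group
   (A, .) of the skew brace; the mixin adds the second group operation
   [circ], whose identity is the identity of (A, .). *)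
HB.mixin Record Group_isSkewBrace A of Group A := {
  circ : A -> A -> A;
  circV : A -> A;
  circA : associative circ;
  circ1g : left_id 1 circ;
  circg1 : right_id 1 circ;
  circVg : left_inverse 1 circV circ;
  circgV : right_inverse 1 circV circ;
  circMr : forall a b c : A, circ a (b * c) = circ a b * a^-1 * circ a c
}.

#[short(type="skewBraceType")]
HB.structure Definition SkewBrace := {A of Group_isSkewBrace A & Group A}.

Definition star (A : skewBraceType) (a b : A) : A := a^-1 * circ a b * b^-1.

HB.mixin Record SkewBrace_isTwoSided A of SkewBrace A := {
  circMl : forall a b c : A, circ (a * b) c = circ a c * c^-1 * circ b c
}.

#[short(type="twoSidedSkewBraceType")]
HB.structure Definition TwoSidedSkewBrace :=
  {A of SkewBrace_isTwoSided A & SkewBrace A}.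

HB.mixin Record SkewBrace_hasAssocStar A of SkewBrace A := {
  starA : associative (@star A)
}.

#[short(type="assocTwoSidedSkewBraceType")]
HB.structure Definition AssocTwoSidedSkewBrace :=
  {A of SkewBrace_hasAssocStar A & TwoSidedSkewBrace A}.

Section Subgroups.
Variable G : groupType.
Implicit Types (X Y H K : set G).

Definition is_subgroup H :=
  [/\ H 1, forall x y, H x -> H y -> H (x * y) & forall x, H x -> H x^-1].

Definition generated X : set G := smallest is_subgroup X.

Definition set_mul X Y : set G := [set x * y | x in X & y in Y].

Definition commutator H K : set G :=
  generated [set [~ x, y] | x in H & y in K].

(* The series below are indexed from 1; the value at 0 is never used. *)
Definition lower_central n : set G :=
  iter n.-1 (fun H => commutator H [set: G]) [set: G].

Lemma is_subgroup_generated X : is_subgroup (generated X).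
Proof.
split; first by move=> H [[]].
  by move=> x y Hx Hy H sH; case: (sH) => -[_ + _] _; apply; [apply: Hx|apply: Hy].
by move=> x Hx H sH; case: (sH) => -[_ _ +] _; apply; apply: Hx.
Qed.

Lemma sub_generated X : X `<=` generated X.
Proof. exact: sub_gen_smallest. Qed.

End Subgroups.

Arguments lower_central : clear implicits.

(* All products of n >= 1 elements, bracketed to the left; the bracketing is
   irrelevant because it is only used with associative operations. *)
Definition nfold_products T (op : T -> T -> T) n : set T :=
  [set foldl op a s | a in [set: T] & s in [set s | size s = n.-1]].

Section SkewBraceSeries.
Variable A : skewBraceType.
Implicit Types X Y : set A.

Definition star_set X Y : set A := generated [set star x y | x in X & y in Y].

Definition star_power n : set A :=
  if (n <= 1)%N then [set: A] else generated (nfold_products (@star A) n).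

Definition brace_lower_central n : set A :=
  iter n.-1 (fun X => generated
    (commutator X [set: A] `|` star_set X [set: A] `|` star_set [set: A] X))
  [set: A].

End SkewBraceSeries.

Arguments star_power : clear implicits.
Arguments brace_lower_central : clear implicits.

(* n is the index of the first term of the series S_1, S_2, ... equal to the
   trivial set {e}. *)
Definition first_trivial T (e : T) (S : nat -> set T) n :=
  [/\ (0 < n)%N, S n = [set e] &
      forall m, (0 < m)%N -> S m = [set e] -> (n <= m)%N].

Lemma first_trivial_unique T (e : T) (S : nat -> set T) m n :
  first_trivial e S m -> first_trivial e S n -> m = n.
Proof.
move=> [m0 Sm Hm] [n0 Sn Hn]; apply/eqP; rewrite eqn_leq.
by rewrite (Hm _ n0 Sn) (Hn _ m0 Sm).
Qed.

Lemma first_trivial_exists T (e : T) (S : nat -> set T) :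
  (exists2 n, (0 < n)%N & S n = [set e]) -> exists n, first_trivial e S n.
Proof.
move=> [k k0 Sk].
have ex : exists n, `[< (0 < n)%N /\ S n = [set e] >].
  by exists k; apply/asboolP.
case: (ex_minnP ex) => n /asboolP[n0 Sn] Hn; exists n; split=> // m m0 Sm.
by apply: Hn; apply/asboolP.
Qed.

Definition nilpotent_group (G : groupType) :=
  exists2 n, (0 < n)%N & lower_central G n = [set 1].

Definition group_class (G : groupType) c :=
  first_trivial 1 (lower_central G) c.+1.

Definition centrally_nilpotent (A : skewBraceType) :=
  exists2 n, (0 < n)%N & brace_lower_central A n = [set 1].

Definition central_class (A : skewBraceType) c :=
  first_trivial 1 (brace_lower_central A) c.+1.

Local Open Scope ring_scope.

(* Rings without identity in which x o y := x + y + xy is a group law. *)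
HB.mixin Record Zmodule_isRadicalRing R of GRing.Zmodule R := {
  rmul : R -> R -> R;
  rmulA : associative rmul;
  rmulDl : left_distributive rmul +%R;
  rmulDr : right_distributive rmul +%R;
  rmul_radical : forall x : R, exists y,
    x + y + rmul x y = 0 /\ y + x + rmul y x = 0
}.

#[short(type="radicalRingType")]
HB.structure Definition RadicalRing :=
  {R of Zmodule_isRadicalRing R & GRing.Zmodule R}.

Section RingPowers.
Variable R : radicalRingType.

Definition is_add_subgroup (H : set R) :=
  [/\ H 0, forall x y, H x -> H y -> H (x + y) & forall x, H x -> H (- x)].

Definition ring_power n : set R :=
  smallest is_add_subgroup (nfold_products (@rmul R) n).

Definition nilpotent_ring := exists2 n, (0 < n)%N & ring_power n = [set 0].

End RingPowers.

Arguments ring_power : clear implicits.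
Arguments nilpotent_ring : clear implicits.

Local Close Scope ring_scope.

(* The quotient G / [G, G] of a group, written additively. *)
Section Abelianization.
Variable G : groupType.

Definition derived : set G := commutator [set: G] [set: G].

Definition coset_rel (a b : G) : bool := `[< derived (a^-1 * b) >].

Lemma derived_subgroup : is_subgroup derived.
Proof. exact: is_subgroup_generated. Qed.

Lemma derivedR a b : derived [~ a, b].
Proof. by apply: sub_generated; exists a => //; exists b. Qed.

Lemma coset_rel_equiv : equiv_class_of coset_rel.
Proof.
have [D1 DM DV] := derived_subgroup.
split=> [a|a b|b a c].
- by apply/asboolP; rewrite mulVg.
- apply/asboolP/asboolP => /DV; by rewrite invgM invgK.
- move=> /asboolP ab /asboolP bc; apply/asboolP.
  have := DM _ _ ab bc; by rewrite mulgA -(mulgA a^-1) mulgV mulg1.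
Qed.

Canonical coset_equiv := EquivRelPack coset_rel_equiv.
Canonical coset_encModRel := defaultEncModRel coset_rel.

Definition abelianization := {eq_quot coset_rel}.

HB.instance Definition _ := EqQuotient.on abelianization.
HB.instance Definition _ := Choice.on abelianization.

Definition cls (a : G) : abelianization := \pi_(abelianization)%qT a.

Lemma clsP a b : cls a = cls b <-> derived (a^-1 * b).
Proof.
split; first by move/eqmodP => /asboolP.
by move=> ab; apply/eqmodP/asboolP.
Qed.

Lemma cls_ind (P : abelianization -> Prop) : (forall a, P (cls a)) ->
  forall x, P x.
Proof. by move=> Pcls x; rewrite -[x]reprK; apply: Pcls. Qed.

Lemma cls_repr a : derived (a^-1 * repr (cls a)).
Proof. by apply/clsP; rewrite /cls reprK. Qed.

Lemma clsC a b : cls (a * b) = cls (b * a).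
Proof.
apply/clsP; rewrite invgM.
suff -> : b^-1 * a^-1 * (b * a) = [~ b, a] by exact: derivedR.
by rewrite commgEl conjgE !mulgA.
Qed.

Definition abel_add (x y : abelianization) := cls (repr x * repr y).
Definition abel_opp (x : abelianization) := cls (repr x)^-1.

Lemma derivedJ d a : derived d -> derived (a^-1 * (d * a)).
Proof.
move=> Dd; have [_ DM _] := derived_subgroup.
have := DM _ _ Dd (derivedR d a).
by rewrite commgEl conjgE mulgA mulgV mul1g.
Qed.

Lemma cls_mul_eq a a' b b' :
  cls a = cls a' -> cls b = cls b' -> cls (a * b) = cls (a' * b').
Proof.
have [_ DM _] := derived_subgroup.
move=> /clsP aa' /clsP bb'; apply/clsP.
have := DM _ _ (derivedJ b aa') bb'.
by rewrite invgM !mulgA -(mulgA _ b b^-1) mulgV mulg1.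
Qed.

Lemma cls_inv_eq a a' : cls a = cls a' -> cls a^-1 = cls a'^-1.
Proof.
have [_ _ DV] := derived_subgroup.
move=> /clsP/DV; rewrite invgM invgK => /(derivedJ a'^-1) Daa'.
by apply/clsP; move: Daa'; rewrite !invgK !mulgA mulgV mul1g.
Qed.

Lemma reprcls a : cls (repr (cls a)) = cls a.
Proof. by rewrite /cls reprK. Qed.

Lemma cls_addE a b : abel_add (cls a) (cls b) = cls (a * b).
Proof. by apply: cls_mul_eq; rewrite reprcls. Qed.

Lemma cls_oppE a : abel_opp (cls a) = cls a^-1.
Proof. by apply: cls_inv_eq; rewrite reprcls. Qed.

Lemma abel_addA : associative abel_add.
Proof.
by elim/cls_ind=> a; elim/cls_ind=> b; elim/cls_ind=> c; rewrite !cls_addE mulgA.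
Qed.

Lemma abel_addC : commutative abel_add.
Proof. by elim/cls_ind=> a; elim/cls_ind=> b; rewrite !cls_addE clsC. Qed.

Lemma abel_add0 : left_id (cls 1) abel_add.
Proof. by elim/cls_ind=> a; rewrite cls_addE mul1g. Qed.

Lemma abel_addN : left_inverse (cls 1) abel_opp abel_add.
Proof. by elim/cls_ind=> a; rewrite cls_oppE cls_addE mulVg. Qed.

HB.instance Definition _ := GRing.isZmodule.Build abelianization
  abel_addA abel_addC abel_add0 abel_addN.

Lemma clsM a b : cls (a * b) = (cls a + cls b)%R.
Proof. by rewrite -cls_addE. Qed.

Lemma clsV a : cls a^-1 = (- cls a)%R.
Proof. by rewrite -cls_oppE. Qed.

Lemma cls1 : cls 1 = 0%R.
Proof. by []. Qed.

End Abelianization.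

Arguments derived : clear implicits.

Section DerivedMorph.
Variables (G : groupType) (f : G -> G).
Hypothesis fM : {morph f : x y / x * y}.

Lemma derived_morph x : derived G x -> derived G (f x).
Proof.
have f1 : f 1 = 1 by apply: (mulgI (f 1)); rewrite -fM !mulg1.
have fV y : f y^-1 = (f y)^-1 by apply: (mulIg (f y)); rewrite -fM !mulVg.
have [D1 DM DV] := derived_subgroup G.
apply: (smallest_sub (C := @is_subgroup G) (X := f @^-1` derived G)).
  split; rewrite /preimage /=; first by rewrite f1.
    by move=> y z; rewrite fM; apply: DM.
  by move=> y; rewrite fV; apply: DV.
move=> _ [y _ [z _ <-]]; rewrite /preimage /= !commgEl !conjgE !(fM, fV).
by rewrite -conjgE -commgEl; apply: derivedR.
Qed.

Lemma cls_morph_eq a a' : cls a = cls a' -> cls (f a) = cls (f a').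
Proof.
have f1 : f 1 = 1 by apply: (mulgI (f 1)); rewrite -fM !mulg1.
have fV y : f y^-1 = (f y)^-1 by apply: (mulIg (f y)); rewrite -fM !mulVg.
by move=> /clsP/derived_morph; rewrite fM fV => ?; apply/clsP.
Qed.

End DerivedMorph.

Section AssociatedRing.
Variable A : assocTwoSidedSkewBraceType.
Local Notation R := (abelianization A).

Lemma lmulM a : {morph (fun b : A => a^-1 * circ a b) : x y / x * y}.
Proof. by move=> x y; rewrite circMr !mulgA. Qed.

Lemma rmulM c : {morph (fun a : A => circ a c * c^-1) : x y / x * y}.
Proof. by move=> x y; rewrite circMl !mulgA. Qed.

Lemma cls_starE (a b : A) :
  cls (star a b) = (cls (circ a b * b^-1) - cls a)%R.
Proof. by rewrite /star -mulgA clsM clsV addrC. Qed.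

Lemma cls_starE' (a b : A) :
  cls (star a b) = (cls (a^-1 * circ a b) - cls b)%R.
Proof. by rewrite /star clsM clsV. Qed.

Lemma cls_star_eq (a a' b b' : A) :
  cls a = cls a' -> cls b = cls b' -> cls (star a b) = cls (star a' b').
Proof.
move=> aa' bb'; apply: (@etrans _ _ (cls (star a' b))).
  by rewrite !cls_starE aa'; congr (_ - _)%R; apply: (cls_morph_eq (rmulM b)).
by rewrite !cls_starE' bb'; congr (_ - _)%R; apply: (cls_morph_eq (lmulM a')).
Qed.

(* By [cls_star] below this does not depend on the representatives. *)
Definition abel_star (x y : R) : R := cls (star (repr x) (repr y)).

Lemma cls_star (a b : A) : abel_star (cls a) (cls b) = cls (star a b).
Proof. by apply: cls_star_eq; rewrite reprcls. Qed.

Lemma abel_starA : associative abel_star.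
Proof.
elim/cls_ind=> a; elim/cls_ind=> b; elim/cls_ind=> c.
by rewrite !cls_star starA.
Qed.

Lemma abel_starDl : left_distributive abel_star +%R.
Proof.
elim/cls_ind=> a; elim/cls_ind=> b; elim/cls_ind=> c.
rewrite -clsM !cls_star !cls_starE (rmulM c a b) !clsM.
by rewrite opprD addrACA.
Qed.

Lemma abel_starDr : right_distributive abel_star +%R.
Proof.
elim/cls_ind=> a; elim/cls_ind=> b; elim/cls_ind=> c.
rewrite -clsM !cls_star !cls_starE' (lmulM a b c) !clsM.
by rewrite opprD addrACA.
Qed.

Lemma cls_circ (a b : A) :
  cls (circ a b) = (cls a + cls b + abel_star (cls a) (cls b))%R.
Proof.
rewrite cls_star cls_starE' clsM clsV.
by rewrite [RHS]addrC [X in (_ + X)%R]addrC addrA subrK addrAC addNr add0r.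
Qed.

Lemma abel_star_radical (x : R) : exists y : R,
  (x + y + abel_star x y = 0 /\ y + x + abel_star y x = 0)%R.
Proof.
elim/cls_ind: x => a; exists (cls (circV a)).
by rewrite -!cls_circ circgV circVg cls1.
Qed.

HB.instance Definition _ := Zmodule_isRadicalRing.Build R
  abel_starA abel_starDl abel_starDr abel_star_radical.

End AssociatedRing.

Definition associated_ring (A : assocTwoSidedSkewBraceType) : radicalRingType :=
  abelianization A.

Lemma associated_ring_add (A : assocTwoSidedSkewBraceType) (a b : A) :
  ((cls a : associated_ring A) + cls b = cls (a * b))%R.
Proof. by rewrite clsM. Qed.

Lemma associated_ring_mul (A : assocTwoSidedSkewBraceType) (a b : A) :
  rmul (cls a : associated_ring A) (cls b) = cls (star a b).
Proof. exact: cls_star. Qed.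

Lemma associated_ring_eq (A : assocTwoSidedSkewBraceType) (a b : A) :
  (cls a : associated_ring A) = cls b <->
  commutator [set: A] [set: A] (a^-1 * b).
Proof. exact: clsP. Qed.

(* Main.v *)
Require Import Defs.
From HB Require Import structures.
From mathcomp Require Import all_boot all_order all_algebra.
From mathcomp Require Import zify generic_quotient boolp classical_sets.

Set Implicit Arguments.
Unset Strict Implicit.
Unset Printing Implicit Defensive.

Local Open Scope classical_set_scope.
Local Open Scope quotient_scope.
Local Open Scope group_scope.

(** Everything follows from one fact, [star_central]: every element [star a b]
    is central in the group (A, .).  Once it is known, the two laws
    [star (a * b) c = star a c ^ b * star b c] and
    [star a (b * c) = star a b * star a c ^ b^-1] say that [star] is a
    bimultiplicative map into an abelian group, so it kills commutators on
    both sides ([star_derived]).  Hence, for n >= 2, in the recursive definition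
    of the brace series applied to the product of the n-th terms of the two
    other series, the factor from the group series contributes only to the
    commutator and the central factor from the star powers only to the star
    products; this is [brace_lower_centralE].  Moreover R^n = 0 means that the
    n-th star power lies in the derived subgroup ([ring_power_trivial]), in
    which case the next star power is trivial ([star_power_trivialS]).  So
    nu_R <= nu_A <= nu_R + 1, and the statements on classes become arithmetic.

    Centrality of [star a b] is obtained in four stages.

    - Expanding [star (a * b) (c * d)] in two ways shows that the centraliser C
      of all star products contains every [c^-1 * circ b c * b^-1].  Modulo C,
      [star b c] is therefore the commutator of b and [c^-1].  When such a
      commutator operation is associative, its triple products are trivial
      ([assoc_commutator_trivial]), so triple star products lie in C.

    - Comparing the two expansions of [star (circ a b) c], one from the action
      of (A, circ) by the automorphisms [lambda a] and one from
      [circ a b = a * star a b * b], gives the relation [star_assoc_rel].  For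
      c = q a star product, it says that b commutes with
      [star a (lambda b q)]; since [lambda b] permutes the star products,
      triple star products are central.

    - The map [z |-> z * star z c] is an endomorphism.  It multiplies both a
      star product u and its conjugate [u ^ b] by the same central element,
      which forces star products to commute with one another.

    - Now [star_assoc_rel] collapses to [star a c ^ b = star a c]. *)

(** * Quotients and commutators in groups *)

(** Normalises words of a group to left-bracketed reduced form. *)
Ltac group_word :=
  rewrite ?(conjgE, commgEl, invgM, invgK, invg1, mulgA, mulgK, mulgVK,
            mulgV, mulVg, mul1g, mulg1).

Lemma commute_conj (G : groupType) (x y : G) : commute x y <-> y ^ x = y.
Proof.
rewrite /commute conjgE; split=> [xy|/(congr1 (fun z => x * z))].
  by rewrite -xy mulKg.
by rewrite mulVKg.
Qed.

Section Quotient.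
Variables (G : groupType) (N : set G).
Hypotheses (sN : is_subgroup N) (nN : forall x y, N x -> N (x ^ y)).

Let rel (a b : G) : bool := `[< N (a^-1 * b) >].

Let rel_equiv : equiv_class_of rel.
Proof.
have [N1 NM NV] := sN; split=> [a|a b|b a c].
- by apply/asboolP; rewrite mulVg.
- by apply/asboolP/asboolP => /NV; rewrite invgM invgK.
- move=> /asboolP ab /asboolP bc; apply/asboolP.
  by have := NM _ _ ab bc; group_word.
Qed.

Let rel_canonical := EquivRelPack rel_equiv.
Let quot := {eq_quot rel_canonical}.

Let pi (a : G) : quot := \pi_quot a.

Let piP a b : pi a = pi b <-> N (a^-1 * b).
Proof.
split; first by move/eqmodP => /asboolP.
by move=> ab; apply/eqmodP/asboolP.
Qed.

Let piM a a' b b' : pi a = pi a' -> pi b = pi b' -> pi (a * b) = pi (a' * b').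
Proof.
have [_ NM _] := sN; move=> /piP/(@nN _ b) aa' /piP bb'; apply/piP.
by have := NM _ _ aa' bb'; group_word.
Qed.

Let piV a a' : pi a = pi a' -> pi a^-1 = pi a'^-1.
Proof.
have [_ _ NV] := sN; move=> /piP/NV/(@nN _ a^-1) aa'; apply/piP.
by move: aa'; group_word.
Qed.

Let pi_repr (x : quot) : pi (repr x) = x. Proof. exact: reprK. Qed.

Let mul (x y : quot) := pi (repr x * repr y).
Let inv (x : quot) := pi (repr x)^-1.

Let mulE a b : mul (pi a) (pi b) = pi (a * b).
Proof. by apply: piM; rewrite pi_repr. Qed.

Let invE a : inv (pi a) = pi a^-1.
Proof. by apply: piV; rewrite pi_repr. Qed.

(** The quotient is delivered through its projection alone: congruences modulo
    N then become equations between images under f. *)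
Lemma quotient_group : exists (Q : groupType) (f : G -> Q),
  {morph f : x y / x * y} /\ forall x, f x = 1 <-> N x.
Proof.
have mulA : associative mul.
  by move=> x y z; rewrite -[x]pi_repr -[y]pi_repr -[z]pi_repr !mulE mulgA.
have mul1 : left_id (pi 1) mul.
  by move=> x; rewrite -[x]pi_repr mulE mul1g.
have mul1' : right_id (pi 1) mul.
  by move=> x; rewrite -[x]pi_repr mulE mulg1.
have mulV : left_inverse (pi 1) inv mul.
  by move=> x; rewrite -[x]pi_repr invE mulE mulVg.
have mulV' : right_inverse (pi 1) inv mul.
  by move=> x; rewrite -[x]pi_repr invE mulE mulgV.
pose m := isGroup.Build quot mulA mul1 mul1' mulV mulV'.
pose Q : groupType := HB.pack quot (Choice.on {eq_quot rel_canonical}) m.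
exists Q, pi; split=> [x y|x]; first exact/esym/mulE.
have [_ _ NV] := sN.
split=> [/piP/NV|Nx]; first by group_word.
by apply/piP; move/NV: Nx; group_word.
Qed.

End Quotient.

Lemma hall_witt (G : groupType) (x y z : G) :
  [~ x, y^-1, z] ^ y * [~ y, z^-1, x] ^ z * [~ z, x^-1, y] ^ x = 1.
Proof. by group_word. Qed.

(** An associative commutator operation vanishes on triples: by associativity
    [f (op a b)] commutes with [f a] and [f b], because [op a a] is trivial.
    Hence [op] is antisymmetric, and moving one factor of a triple product
    cyclically inverts it.  The three terms of the Hall-Witt identity are then
    the inverse t^-1 of one triple product, its inverse t, and t^-1 again. *)
Lemma assoc_commutator_trivial (T : Type) (op : T -> T -> T) (G : groupType)
    (f : T -> G) :
    associative op -> (forall a b, f (op a b) = [~ f a, (f b)^-1]) ->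
  forall a b c, f (op (op a b) c) = 1.
Proof.
move=> opA fE.
have op0 a b : f b = 1 -> f (op a b) = 1 by rewrite fE => ->; group_word.
have op0' a b : f a = 1 -> f (op a b) = 1 by rewrite fE => ->; group_word.
have opxx a : f (op a a) = 1 by rewrite fE; group_word.
have opr a b : commute (f (op a b)) (f b).
  apply/commute_sym; rewrite -[f b]invgK; apply/commute_sym/commuteV.
  by apply/commgP/eqP; rewrite -fE -opA op0.
have opl a b : commute (f a) (f (op a b)).
  rewrite -[f (op a b)]invgK; apply/commuteV.
  by apply/commgP/eqP; rewrite -fE opA op0'.
have opC a b : f (op b a) = (f (op a b))^-1.
  have -> : f (op b a) = (f (op a b))^-1 ^ ((f a)^-1 * f b).
    by rewrite !fE; group_word.
  apply/commute_conj/commuteV/commute_sym/commuteM; last exact: opr.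
  exact/commuteV/commute_sym.
move=> a b c.
have cyc x y z : f (op (op x y) z) = (f (op (op y z) x))^-1.
  by rewrite -opA opC.
have cz x y z : commute (f (op (op x y) z)) (f z) by exact: opr.
have cx x y z : commute (f (op (op x y) z)) (f x).
  by rewrite -opA; apply/commute_sym/opl.
have cy x y z : commute (f (op (op x y) z)) (f y).
  by rewrite cyc; apply/commute_sym/commuteV/commute_sym/cx.
have tE x y z : [~ f x, (f y)^-1, f z] ^ f y = (f (op (op x y) z))^-1.
  rewrite -fE; have -> : [~ f (op x y), f z] = (f (op (op x y) z))^-1 ^ f z.
    by rewrite (fE (op x y)); group_word.
  have tV u : commute (f (op (op x y) z)) u ->
      (f (op (op x y) z))^-1 ^ u = (f (op (op x y) z))^-1.
    by move=> ?; apply/commute_conj/commuteV/commute_sym.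
  by rewrite !tV.
have := hall_witt (f a) (f b) (f c); rewrite !tE.
rewrite (cyc b c a) (cyc c a b) !invgK mulgVK => /eqP.
by rewrite invg_eq1 => /eqP.
Qed.

(** * Star products are central *)

Section StarCentral.
Variable A : assocTwoSidedSkewBraceType.
Implicit Types a b c d x y z : A.

Lemma circE a b : circ a b = a * star a b * b.
Proof. by rewrite /star; group_word. Qed.

Lemma star1g a : star 1 a = 1.
Proof. by rewrite /star circ1g; group_word. Qed.

Lemma starg1 a : star a 1 = 1.
Proof. by rewrite /star circg1; group_word. Qed.

Lemma starMl a b c : star (a * b) c = star a c ^ b * star b c.
Proof. by rewrite /star circMl; group_word. Qed.

Lemma starMr a b c : star a (b * c) = star a b * star a c ^ b^-1.
Proof. by rewrite /star circMr; group_word. Qed.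

Lemma star_conj_r a b y : star a b ^ y^-1 = (star a y)^-1 * star a (y * b).
Proof. by rewrite starMr; group_word. Qed.

Lemma star_circl a b c :
  star (circ a b) c = star a (star b c) * star b c * star a c.
Proof.
rewrite {1}/star -circA (circE b c); move: (star b c) => s.
by rewrite !circMr /star; group_word.
Qed.

(** The two ways of expanding [star (a * b) (c * d)], by [starMl] first or by
    [starMr] first, differ only in the position of [star a d]. *)
Lemma star_commutes_circ a d b c :
  commute (star a d) (c^-1 * circ b c * b^-1).
Proof.
have := starMl a b (c * d); rewrite starMr !starMl !starMr circE.
move: (star a c) (star a d) (star b c) (star b d) => p u q v.
move=> /(congr1 (fun w => c^-1 * p^-1 * b * w * c * v^-1 * b^-1)).
by rewrite /commute; group_word.
Qed.

(** The action of (A, circ) on (A, .) by automorphisms. *)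
Definition lambda a b : A := a^-1 * circ a b.

Lemma lambdaM a : {morph lambda a : x y / x * y}.
Proof. exact: lmulM. Qed.

Lemma lambda_star_mul a b : lambda a b = star a b * b.
Proof. by rewrite /lambda /star; group_word. Qed.

Lemma lambda1 b : lambda 1 b = b.
Proof. by rewrite /lambda circ1g; group_word. Qed.

Lemma lambdaV a b : lambda a b^-1 = (lambda a b)^-1.
Proof.
apply: (mulIg (lambda a b)).
by rewrite -lambdaM !mulVg lambda_star_mul starg1 mulg1.
Qed.

Lemma lambda_circ a b c : lambda (circ a b) c = lambda a (lambda b c).
Proof. by rewrite {3}/lambda lambdaM lambdaV /lambda circA; group_word. Qed.

(** Each [lambda x] maps star products to star products, because it carries the
    action of a to the action of the conjugate of a by x in (A, circ). *)
Lemma lambda_star x a b :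
  lambda x (star a b) = star (circ (circ x a) (circV x)) (lambda x b).
Proof.
have starE c d : star c d = lambda c d * d^-1.
  by rewrite lambda_star_mul mulgK.
by rewrite !starE lambdaM lambdaV -!lambda_circ -!circA circVg circg1.
Qed.

(** Modulo the centraliser C of the star products, [star c d] is the
    commutator of c and [d^-1], so [assoc_commutator_trivial] applies. *)
Lemma star_star_commutes a b x y z : commute (star a b) (star (star x y) z).
Proof.
pose C : set A := [set u | forall a b, commute (star a b) u].
have sC : is_subgroup C.
  split=> [c d|u v Cu Cv c d|u Cu c d]; first exact: commute1.
    exact: commuteM.
  exact: commuteV.
have nC u v : C u -> C (u ^ v).
  move=> Cu c d; have /commute_conj uE : commute (star c d ^ v^-1) u.
    rewrite star_conj_r; apply/commute_sym/commuteM; last exact/commute_sym/Cu.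
    exact/commuteV/commute_sym/Cu.
  by apply/commute_conj; rewrite -{2}uE; group_word.
have [Q [f [fM f1]]] := quotient_group sC nC.
have fone : f 1 = 1 by apply: (mulgI (f 1)); rewrite -fM !mulg1.
have fV u : f u^-1 = (f u)^-1 by apply: (mulIg (f u)); rewrite -fM !mulVg.
have fstar c d : f (star c d) = [~ f c, (f d)^-1].
  have /f1 : C (d^-1 * circ c d * c^-1).
    by move=> u v; apply: star_commutes_circ.
  rewrite circE !fM !fV.
  move=> /(congr1 (fun w => [~ f c, (f d)^-1] * w ^ (f c * (f d)^-1))).
  by group_word.
have /f1 Cxyz := assoc_commutator_trivial (@starA A) fstar x y z.
exact: Cxyz.
Qed.

(** The action of [circ a b] on c, computed on the left by composing the actions
    of b and a, and on the right from [circ a b = a * star a b * b]. *)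
Lemma star_assoc_rel a b c :
  star a (star b c) * star b c * star a c =
  (star a c ^ star a b * star (star a b) c) ^ b * star b c.
Proof. by rewrite -star_circl circE !starMl. Qed.

(** When q is a star product, all factors of [star_assoc_rel a b q] commute
    with star products, and the relation says that conjugation by b fixes
    [star a (lambda b q)]. *)
Lemma star3_central a x y b : commute (star a (star x y)) b.
Proof.
apply/commute_sym.
have key u v : commute b (star a (lambda b (star u v))).
  set q := star u v.
  have tC c d e : commute (star c q) (star d e).
    by rewrite starA; apply/commute_sym/star_star_commutes.
  rewrite lambda_star_mul starMr.
  have -> : star a q ^ (star b q)^-1 = star a q.
    by apply/commute_conj/commute_sym/commuteV/tC.
  have := star_assoc_rel a b q; rewrite -starA.
  rewrite (_ : star a q ^ star a b = star a q); last first.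
    by apply/commute_conj/commute_sym/tC.
  rewrite -mulgA (tC b a q) mulgA => /mulIg.
  rewrite -(tC a a (star b q)) => sE; apply/commute_conj; exact/esym.
(* Every star product is [lambda b] of a star product. *)
have -> : star x y = lambda b (lambda (circV b) (star x y)).
  by rewrite -lambda_circ circgV lambda1.
by rewrite lambda_star; apply: key.
Qed.

(** Both u = [star x y] and [u ^ b] are multiplied by the central element
    [star u c] under the endomorphism [rho], while b becomes [b * star b c];
    so conjugating by b or by [b * star b c] has the same effect on u. *)
Lemma star_commutes_star_conj x y b c : commute (star x y ^ b) (star b c).
Proof.
set u := star x y.
have uc : star (u ^ b) c = star u c.
  have := starMl (u ^ b) (star b y) c.
  have -> : u ^ b * star b y = star (x * b) y.
    by rewrite starMl.
  rewrite -!starA starMl => /mulIg.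
  rewrite (commute_conj _ _).1; last exact/commute_sym/star3_central.
  move=> /(congr1 (conjg^~ (star b y)^-1)); rewrite conjgK => <-.
  exact/commute_conj/commute_sym/star3_central.
pose rho z := circ z c * c^-1.
have rhoM : {morph rho : z t / z * t} by exact: rmulM.
have rhoE z : rho z = z * star z c by rewrite /rho /star; group_word.
have rhoJ z t : rho (z ^ t) = rho z ^ rho t.
  apply: (mulgI (rho t)); rewrite -rhoM conjgE mulVKg.
  by rewrite rhoM conjgE mulVKg.
move: (rhoJ u b); rewrite !rhoE uc (conjMg u).
have tC z : star u c ^ z = star u c.
  by rewrite -starA; apply/commute_conj/commute_sym/star3_central.
by rewrite tC conjgM => /mulIg/esym/commute_conj/commute_sym.
Qed.

Lemma star_star_commute u v x y : commute (star u v) (star x y).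
Proof.
(* Conjugates by x commute with [star x y], and [star u v] is a product of such
   conjugates of star products and their inverses. *)
have -> : star u v = (star u x ^ x)^-1 * star u (x * v) ^ x.
  by rewrite starMr; group_word.
apply/commute_sym/commuteM; last exact/commute_sym/star_commutes_star_conj.
exact/commuteV/commute_sym/star_commutes_star_conj.
Qed.

Lemma star_central a b x : commute (star a b) x.
Proof.
have := star_assoc_rel a x b.
rewrite -starA -mulgA (star_star_commute x b) mulgA => /mulIg.
rewrite (_ : star a b ^ star a x = star a b); last first.
  exact/commute_conj/star_star_commute.
rewrite conjMg (_ : star a (star x b) ^ x = star a (star x b)); last first.
  by apply/commute_conj/commute_sym/star3_central.
by rewrite star3_central => /mulIg/esym/commute_conj/commute_sym.
Qed.

End StarCentral.

(** * Series of subgroups *)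

Lemma generated_sub (G : groupType) (X H : set G) :
  is_subgroup H -> X `<=` H -> generated X `<=` H.
Proof. by move=> sH XH; apply: smallest_sub. Qed.

Lemma lower_central_subgroup (G : groupType) n :
  is_subgroup (lower_central G n.+1).
Proof. by case: n => // n; apply: is_subgroup_generated. Qed.

Lemma lower_central_derived (G : groupType) n :
  lower_central G n.+2 `<=` derived G.
Proof.
apply: generated_sub; first exact: derived_subgroup.
by move=> _ [x _ [y _ <-]]; apply: derivedR.
Qed.

Lemma lower_centralR (G : groupType) n (x y : G) :
  lower_central G n.+1 x -> lower_central G n.+2 [~ x, y].
Proof. by move=> gx; apply: sub_generated; exists x => //; exists y. Qed.

Lemma set_mul_subgroup (G : groupType) (H K : set G) :
    is_subgroup H -> is_subgroup K -> (forall x y : G, K x -> commute x y) ->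
  is_subgroup (set_mul H K).
Proof.
move=> [H1 HM HV] [K1 KM KV] KC; split.
    by exists 1 => //; exists 1; rewrite ?mulg1.
  move=> _ _ [x Hx [u Ku <-]] [y Hy [v Kv <-]].
  exists (x * y); first exact: HM.
  by exists (u * v); [exact: KM|rewrite mulgA -(mulgA x) -(KC u y Ku) !mulgA].
move=> _ [x Hx [u Ku <-]]; exists x^-1; first exact: HV.
by exists u^-1; [exact: KV|rewrite invgM (KC _ _ (KV _ Ku))].
Qed.

Lemma set_mul1r (G : groupType) (H K : set G) :
  is_subgroup H -> K `<=` set_mul H K.
Proof. by case=> H1 _ _ x Kx; exists 1 => //; exists x; rewrite ?mul1g. Qed.

Lemma set_mul1l (G : groupType) (H K : set G) :
  is_subgroup K -> H `<=` set_mul H K.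
Proof. by case=> K1 _ _ x Hx; exists x => //; exists 1; rewrite ?mulg1. Qed.

Lemma first_trivial_leq T (e : T) (S : nat -> set T) m n :
    (forall n, S n.+1 = [set e] -> S n.+2 = [set e]) ->
  first_trivial e S m -> (0 < n)%N -> S n = [set e] <-> (m <= n)%N.
Proof.
move=> Sd [m0 Sm mmin] n0; split=> [|mn]; first exact: mmin.
rewrite -(subnKC mn); elim: (n - m)%N => [|k IH]; first by rewrite addn0.
by case: m m0 IH {Sm mmin mn} => // m _ IH; rewrite addnS addSn; apply: Sd.
Qed.

Lemma subgroup_trivial (G : groupType) (H : set G) :
  is_subgroup H -> (H = [set 1] <-> H `<=` [set 1]).
Proof.
by case=> H1 _ _; split=> [->//|H0]; apply/seteqP; split=> // _ ->.
Qed.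

Lemma lower_central_trivialS (G : groupType) n :
  lower_central G n.+1 = [set 1] -> lower_central G n.+2 = [set 1].
Proof.
move=> G1; apply/subgroup_trivial; first exact: lower_central_subgroup.
apply: generated_sub.
  by split=> [|x y -> ->|x ->] //; rewrite /set1 /= ?mulg1 ?invg1.
move=> _ [x gx [y _ <-]]; have : lower_central G n.+1 x := gx.
by rewrite G1 => ->; rewrite comm1g.
Qed.

(** * Star powers *)

Section StarPowers.
Variable A : assocTwoSidedSkewBraceType.
Implicit Types a b c x y : A.

Lemma star_morphl a b c : star (a * b) c = star a c * star b c.
Proof.
by rewrite starMl (commute_conj _ _).1 //; apply/commute_sym/star_central.
Qed.

Lemma star_morphr a b c : star a (b * c) = star a b * star a c.
Proof.
by rewrite starMr (commute_conj _ _).1 //; apply/commute_sym/star_central.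
Qed.

Lemma starVl a c : star a^-1 c = (star a c)^-1.
Proof. by apply: (mulIg (star a c)); rewrite -star_morphl !mulVg star1g. Qed.

Lemma starVr a c : star a c^-1 = (star a c)^-1.
Proof. by apply: (mulIg (star a c)); rewrite -star_morphr !mulVg starg1. Qed.

(** A multiplicative map into an abelian group kills the derived subgroup. *)
Lemma star_derived d : derived A d -> forall c, star d c = 1 /\ star c d = 1.
Proof.
pose K : set A := [set d | forall c, star d c = 1 /\ star c d = 1].
suff : derived A `<=` K by exact.
apply: generated_sub.
  split=> [c|x y Kx Ky c|x Kx c]; first by rewrite star1g starg1.
    rewrite star_morphl star_morphr (Kx c).1 (Kx c).2 (Ky c).1 (Ky c).2.
    by rewrite mulg1.
  by rewrite starVl starVr (Kx c).1 (Kx c).2 invg1.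
move=> _ [x _ [y _ <-]] c; rewrite commgEl conjgE.
rewrite !star_morphl !star_morphr !starVl !starVr; split; last first.
  by rewrite (star_central c x (star c y)); group_word.
by rewrite (star_central x c (star y c)); group_word.
Qed.

Lemma star_derived_l d c : derived A d -> star d c = 1.
Proof. by move=> /star_derived/(_ c)[]. Qed.

Lemma star_derived_r d c : derived A d -> star c d = 1.
Proof. by move=> /star_derived/(_ c)[]. Qed.

Lemma star_power_subgroup n : is_subgroup (star_power A n).
Proof.
by rewrite /star_power; case: ifP => // _; apply: is_subgroup_generated.
Qed.

Lemma star_power_foldl a s : star_power A (size s).+1 (foldl (@star A) a s).
Proof.
rewrite /star_power; case: ifP => // _.
by apply: sub_generated; exists a => //; exists s.
Qed.

Lemma star_power_ind n (H : set A) : is_subgroup H ->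
    (forall a b s, size s = n -> H (foldl (@star A) a (rcons s b))) ->
  star_power A n.+2 `<=` H.
Proof.
move=> sH Hgen; apply: generated_sub => // _ [a _ [s /= ss <-]].
by case/lastP: s ss => // s b; rewrite size_rcons => -[/Hgen].
Qed.

Lemma star_power_central n u x : star_power A n.+2 u -> commute u x.
Proof.
move=> Pu; apply/commute_sym; move: u Pu.
apply: (star_power_ind (H := [set u | commute x u])).
  split; [exact: commute1|exact: commuteM|exact: commuteV].
by move=> a b s _; rewrite foldl_rcons; apply/commute_sym/star_central.
Qed.

Lemma star_power_starr n u c :
  star_power A n.+1 u -> star_power A n.+2 (star u c).
Proof.
case: n u => [|n] u; first by move=> _; apply: (@star_power_foldl u [:: c]).
have [P1 PM PV] := star_power_subgroup n.+3.
move: u; apply: (star_power_ind (H := [set u | star_power A n.+3 (star u c)])).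
  split=> [|x y Px Py|x Px] /=; first by rewrite star1g.
    by rewrite star_morphl; apply: PM.
  by rewrite starVl; apply: PV.
move=> a b s <-; rewrite /= -foldl_rcons -2!(size_rcons _ b).
have := star_power_foldl a (rcons (rcons s b) c).
by rewrite !size_rcons.
Qed.

Lemma foldl_starl c a s :
  star c (foldl (@star A) a s) = foldl (@star A) c (a :: s).
Proof. by elim/last_ind: s => //= s b IH; rewrite !foldl_rcons starA IH. Qed.

Lemma star_power_starl n u c :
  star_power A n.+1 u -> star_power A n.+2 (star c u).
Proof.
case: n u => [|n] u; first by move=> _; apply: (@star_power_foldl c [:: u]).
have [P1 PM PV] := star_power_subgroup n.+3.
move: u; apply: (star_power_ind (H := [set u | star_power A n.+3 (star c u)])).
  split=> [|x y Px Py|x Px] /=; first by rewrite starg1.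
    by rewrite star_morphr; apply: PM.
  by rewrite starVr; apply: PV.
move=> a b s ss; rewrite /= foldl_starl.
have := star_power_foldl c (a :: rcons s b).
by rewrite /= size_rcons ss.
Qed.

(** The next star power is generated by products whose left factor lies in the
    derived subgroup. *)
Lemma star_power_trivialS n :
  star_power A n.+1 `<=` derived A -> star_power A n.+2 = [set 1].
Proof.
move=> PD; apply/subgroup_trivial; first exact: star_power_subgroup.
apply: star_power_ind.
  by split=> [|x y -> ->|x ->] //; rewrite /set1 /= ?mulg1 ?invg1.
move=> a b s ss; rewrite foldl_rcons; apply: star_derived_l; apply: PD.
by rewrite -ss; apply: star_power_foldl.
Qed.

End StarPowers.

(** * The lower central series of the skew brace *)

Section BraceSeries.
Variable A : assocTwoSidedSkewBraceType.

(** In each of the three inclusions from left to right, the first step of the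
    induction is separate, because the first terms of the two series
    on the right are A itself, so the first factor need not be killed by
    [star], nor the second be central. *)
Lemma brace_lower_centralE n : (0 < n)%N ->
  brace_lower_central A n = set_mul (lower_central A n) (star_power A n).
Proof.
case: n => // n _; elim: n => [|n IH].
  by apply/seteqP; split=> // x _; apply: set_mul1r.
set g := lower_central A; set P := star_power A.
have sg k : is_subgroup (g k.+1) := lower_central_subgroup A k.
have sP k : is_subgroup (P k) := star_power_subgroup A k.
have sM : is_subgroup (set_mul (g n.+2) (P n.+2)).
  apply: set_mul_subgroup => // x y; exact: star_power_central.
rewrite /brace_lower_central /= -[iter n _ _]/(brace_lower_central A n.+1) IH.
have [_ PM _] := sP n.+2.
have star_in x y : P n.+2 (star x y) -> set_mul (g n.+2) (P n.+2) (star x y).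
  exact: set_mul1r.
apply/seteqP; split.
  apply: generated_sub => // z [[]|] /=; move: z; apply: generated_sub => //.
  - move=> _ [_ [x gx [u Pu <-]] [y _ <-]]; apply: (set_mul1l (sP _)).
    case: n {IH sM PM star_in} gx Pu => [|n] gx Pu; first exact: lower_centralR.
    suff -> : [~ x * u, y] = [~ x, y] by exact: lower_centralR.
    have uC v : commute u v := star_power_central v Pu.
    rewrite !commgEl conjMg [u ^ y](commute_conj _ _).1; last exact/commute_sym.
    by rewrite invgM -mulgA (mulgA x^-1) -(uC (x^-1 * x ^ y)) mulKg.
  - move=> _ [_ [x gx [u Pu <-]] [y _ <-]]; apply: star_in.
    rewrite star_morphl; apply: PM; last exact: star_power_starr.
    case: n {IH sM} gx Pu => [|n] gx Pu; first exact: star_power_starr.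
    rewrite star_derived_l; first by case: (sP n.+3).
    exact: lower_central_derived gx.
  - move=> _ [y _ [_ [x gx [u Pu <-]] <-]]; apply: star_in.
    rewrite star_morphr; apply: PM; last exact: star_power_starl.
    case: n {IH sM} gx Pu => [|n] gx Pu; first exact: star_power_starl.
    rewrite star_derived_r; first by case: (sP n.+3).
    exact: lower_central_derived gx.
move=> _ [x gx [u Pu <-]].
set M := set_mul (g n.+1) (P n.+1); set X := (X in generated X).
have [_ GM _] := is_subgroup_generated X.
apply: GM.
  have sub : g n.+2 `<=` commutator M [set: A].
    apply: generated_sub; first exact: is_subgroup_generated.
    move=> _ [y gy [z _ <-]]; apply: sub_generated.
    by exists y; [exact: set_mul1l|exists z].
  by apply: sub_generated; left; left; apply: sub.
move: u Pu; apply: star_power_ind; first exact: is_subgroup_generated.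
move=> a b s ss; rewrite foldl_rcons; apply: sub_generated; left; right.
apply: sub_generated; exists (foldl (@star A) a s); last by exists b.
by apply: set_mul1r; [exact: sg|rewrite -ss; exact: star_power_foldl].
Qed.

Lemma brace_lower_central_trivial n : (0 < n)%N ->
  brace_lower_central A n = [set 1] <->
  lower_central A n = [set 1] /\ star_power A n = [set 1].
Proof.
case: n => // n _; rewrite brace_lower_centralE //.
have sg := lower_central_subgroup A n; have sP := star_power_subgroup A n.+1.
split=> [M1|[-> ->]]; last first.
  apply/seteqP; split=> [_ [_ -> [_ -> <-]]|_ ->]; first by rewrite mulg1.
  by exists 1 => //; exists 1; rewrite ?mulg1.
split; apply/subgroup_trivial => //; rewrite -M1.
  exact: set_mul1l.
exact: set_mul1r.
Qed.

End BraceSeries.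

(** * Powers of the associated ring *)

Section RingPowers.
Variable A : assocTwoSidedSkewBraceType.

Lemma cls_foldl (a : A) s :
  cls (foldl (@star A) a s) =
  foldl (@rmul (associated_ring A)) (cls a) (map (@cls A) s).
Proof.
elim/last_ind: s => //= s b IH.
by rewrite map_rcons !foldl_rcons -IH -associated_ring_mul.
Qed.

(** The projection onto R sends n-fold star products to n-fold products, and
    every n-fold product of R arises in this way. *)
Lemma ring_power_trivial n :
  ring_power (associated_ring A) n.+1 = [set 0%R] <->
  star_power A n.+1 `<=` derived A.
Proof.
have cls0 x : cls x = 0%R <-> derived A x.
  rewrite -[0%R]/(cls (1 : A)); split=> [/esym/clsP|Dx].
    by rewrite invg1 mul1g.
  by apply/esym/clsP; rewrite invg1 mul1g.
have sD := derived_subgroup A.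
have r0 : ring_power (associated_ring A) n.+1 0%R by move=> H [[]].
have rgen a s : size s = n ->
    ring_power (associated_ring A) n.+1 (cls (foldl (@star A) a s)).
  move=> ss H [_]; apply; rewrite cls_foldl; exists (cls a) => //.
  by exists (map (@cls A) s) => //=; rewrite size_map.
split=> [R0|PD].
  have foldD a s : size s = n -> derived A (foldl (@star A) a s).
    move=> ss; apply/cls0; have := rgen a s ss; rewrite R0; apply.
  case: n {r0 rgen} R0 foldD => [|n] _ foldD.
    by move=> a _; apply: (foldD a [::]).
  by apply: star_power_ind => // a b s ss; apply: foldD; rewrite size_rcons ss.
apply/seteqP; split=> [|_ ->] //; apply: smallest_sub.
  by split=> [|x y -> ->|x ->] //; rewrite /set1 /= ?GRing.addr0 ?GRing.oppr0.
move=> _ [x _ [s /= ss <-]]; rewrite /set1 /=.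
have -> : foldl (@rmul (associated_ring A)) x s =
    cls (foldl (@star A) (repr x) (map repr s)).
  rewrite cls_foldl -map_comp -[x in LHS]reprK; congr foldl.
  by rewrite -[LHS]map_id; apply: eq_map => y; rewrite /= /cls reprK.
apply/cls0; apply: PD; have := star_power_foldl (repr x) (map repr s).
by rewrite size_map (ss : size s = n).
Qed.

End RingPowers.

(** * Nilpotency and classes *)

Theorem theorem4p11 (A : assocTwoSidedSkewBraceType) :
  [/\ forall n : nat, (1 <= n)%N ->
        brace_lower_central A n = set_mul (lower_central A n) (star_power A n),
      centrally_nilpotent A <->
        nilpotent_group A /\ nilpotent_ring (associated_ring A) &
      [set: A] <> [set 1] ->
      nilpotent_group A -> nilpotent_ring (associated_ring A) ->
      exists c_dot c_A nu_A nu_R : nat,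
        [/\ group_class A c_dot,
            central_class A c_A,
            first_trivial 1 (star_power A) nu_A,
            first_trivial 0%R (ring_power (associated_ring A)) nu_R &
            [/\ c_A = maxn c_dot (nu_A - 1),
                (maxn c_dot (nu_R - 1) <= c_A)%N &
                (c_A <= maxn c_dot nu_R)%N]]].
Proof.
have ringP := @ring_power_trivial A.
have gS := @lower_central_trivialS A.
have PS n : star_power A n.+1 = [set 1] -> star_power A n.+2 = [set 1].
  move=> P1; apply: star_power_trivialS; rewrite P1 => _ ->.
  by case: (derived_subgroup A).
have PR n : star_power A n.+1 = [set 1] ->
    ring_power (associated_ring A) n.+1 = [set 0%R].
  move=> P1; apply/ringP; rewrite P1 => _ ->; by case: (derived_subgroup A).
have nil : centrally_nilpotent A <->
    nilpotent_group A /\ nilpotent_ring (associated_ring A).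
  split=> [[[//|n] _] /(brace_lower_central_trivial _)[]//|].
    by move=> g1 P1; split; exists n.+1 => //; apply: PR.
  move=> [gn [[//|n] _ /ringP/star_power_trivialS P1]].
  have [m gm] := first_trivial_exists gn.
  have [k Pk] : exists k, first_trivial 1 (star_power A) k.
    by apply: first_trivial_exists; exists n.+2.
  have m0 : (0 < m)%N by case: gm.
  exists (maxn m k); first by rewrite leq_max m0.
  apply/brace_lower_central_trivial; first by rewrite leq_max m0.
  split; [apply/(first_trivial_leq gS gm)|apply/(first_trivial_leq PS Pk)];
    by rewrite ?leq_max ?m0 ?leqnn ?orbT.
split=> // [n n0|A1 gn Rn]; first exact: brace_lower_centralE.
have [m gm] := first_trivial_exists gn.
have [l Gl] := first_trivial_exists (nil.2 (conj gn Rn)).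
have [r Rr] := first_trivial_exists Rn.
have [k Pk] : exists k, first_trivial 1 (star_power A) k.
  apply: first_trivial_exists.
  have [l0 /(brace_lower_central_trivial _ l0)[_ P1] _] := Gl.
  by exists l.
have pos S i : S 1%N = [set: A] -> first_trivial 1 S i -> (1 < i)%N.
  by move=> S1 [i0 Si _]; case: i i0 Si => [|[|i]] // _; rewrite S1.
have m1 := pos _ _ erefl gm; have l1 := pos _ _ erefl Gl.
have k1 := pos _ _ erefl Pk.
have [m0 l0 k0] := And3 (ltnW m1) (ltnW l1) (ltnW k1).
have r0 : (0 < r)%N by case: Rr.
have lE : l = maxn m k.
  have mk0 : (0 < maxn m k)%N by rewrite leq_max m0.
  apply/eqP; rewrite eqn_leq geq_max; apply/andP; split.
    case: Gl => _ _; apply => //; apply/brace_lower_central_trivial => //.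
    split; [apply/(first_trivial_leq gS gm)|apply/(first_trivial_leq PS Pk)];
    by rewrite // leq_max leqnn ?orbT.
  have [_ /(brace_lower_central_trivial _ l0)[g1 P1] _] := Gl.
  by apply/andP; split; [case: gm => _ _; apply|case: Pk => _ _; apply].
have rk : (r <= k)%N.
  case: Rr => _ _; apply => //; case: Pk => _ + _; case: k k0 {k1 lE} => // k _.
  exact: PR.
have kr : (k <= r.+1)%N.
  case: Rr => _ + _; case: r r0 {rk} => // r _ /ringP/star_power_trivialS P1.
  by case: Pk => _ _; apply.
exists m.-1, l.-1, k, r.
rewrite /group_class /central_class !prednK //; split=> //.
by split; lia.
Qed.
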